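(* Let $\Gamma$ and $\Sigma$ be two connected graphs, each with at least two vertices. Then: (i) if one of $\Gamma$ and $\Sigma$ is bipartite and the other has a TF-morphism $(\alpha,\beta)$ with $\alpha\ne\beta$, then $\Gamma\Box\Sigma$ is unstable; (ii) if one of $\Gamma$ and $\Sigma$ is bipartite and the other is $R$-thick, then $\Gamma\boxtimes\Sigma$ is unstable; (iii) if $\Gamma$ or $\Sigma$ has a TFS-morphism, then the complement $\overline{\Gamma\boxtimes\Sigma}$ is unstable; (iv) if $\Sigma$ is unstable or $\Gamma$ has a TFS-morphism, then $\Gamma\ltimes\Sigma$ is unstable; (v) if $\Sigma$ has a TF-morphism $(\alpha,\beta)$ with $\alpha\ne\beta$, then $\Gamma[\Sigma]$ is unstable.
   Context: All graphs are finite, undirected and simple. For a permutation $\alpha$ and point $x$, $x^\alpha$ denotes the image of $x$. A TF-morphism of a graph $\Gamma$ is an ordered pair $(\alpha,\beta)$ of permutations of $V(\Gamma)$ such that $u\sim_\Gamma v$ implies $u^\alpha\sim_\Gamma v^\beta$. A TFS-morphism of $\Gamma$ is an ordered pair $(\alpha,\beta)$ of permutations of $V(\Gamma)$ such that $u^\alpha\sim_\Gamma u^\beta$ for every vertex $u$, and for every pair of adjacent vertices $u,v$, either $u^\alpha\sim_\Gamma v^\beta$ or $u^\alpha=v^\beta$. A graph is $R$-thick if two distinct vertices have the same neighbourhood. The complement $\overline{\Lambda}$ has the same vertex set, with $u\sim v$ iff $u\ne v$ and $u\not\sim_\Lambda v$. All products below have vertex set $V(\Gamma)\times V(\Sigma)$: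 in the Cartesian product $\Gamma\Box\Sigma$, $(a,x)\sim(b,y)$ iff ($a=b$ and $x\sim_\Sigma y$) or ($a\sim_\Gamma b$ and $x=y$); in the strong product $\Gamma\boxtimes\Sigma$, iff ($a=b$ and $x\sim_\Sigma y$) or ($a\sim_\Gamma b$ and $x\sim_\Sigma y$) or ($a\sim_\Gamma b$ and $x=y$); in the semi-strong product $\Gamma\ltimes\Sigma$, iff ($a\sim_\Gamma b$ or $a=b$) and $x\sim_\Sigma y$; in the lexicographic product $\Gamma[\Sigma]$, iff $a\sim_\Gamma b$, or ($a=b$ and $x\sim_\Sigma y$). The direct product $\Lambda\times K_2$ has vertex set $V(\Lambda)\times V(K_2)$ with $(a,x)\sim(b,y)$ iff $a\sim b$ and $x\sim y$; $\mathrm{Aut}(\Lambda)\times\mathrm{Aut}(K_2)$ acts coordinatewise on it. A graph $\Lambda$ is stable if $\mathrm{Aut}(\Lambda\times K_2)=\mathrm{Aut}(\Lambda)\times\mathrm{Aut}(K_2)$ and unstable otherwise. *)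

(* Defs.v *)
From mathcomp Require Import all_boot all_fingroup.

Set Implicit Arguments.
Unset Strict Implicit.
Unset Printing Implicit Defensive.

Record sgraph := SGraph {
  vertex :> finType;
  adj : rel vertex;
  adj_sym : symmetric adj;
  adj_irr : irreflexive adj
}.

Notation "u -- v" := (adj u v) (at level 30).

Definition connected (G : sgraph) : Prop :=
  forall u v : G, connect (@adj G) u v.

Definition bipartite (G : sgraph) : Prop :=
  exists A : {set G}, forall u v : G, u -- v -> (u \in A) != (v \in A).

Definition nbh (G : sgraph) (u : G) : {set G} := [set v | u -- v].

Definition R_thick (G : sgraph) : Prop :=
  exists u v : G, u <> v /\ nbh u = nbh v.

Definition TF_morphism (G : sgraph) (alpha beta : {perm G}) : Prop :=
  forall u v : G, u -- v -> alpha u -- beta v.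

Definition TFS_morphism (G : sgraph) (alpha beta : {perm G}) : Prop :=
  (forall u : G, alpha u -- beta u) /\
  (forall u v : G, u -- v -> alpha u -- beta v \/ alpha u = beta v).

Section Complement.
Variable G : sgraph.
Definition compl_rel : rel G := fun u v => (u != v) && ~~ (u -- v).
Fact compl_sym : symmetric compl_rel.
Proof. by move=> u v; rewrite /compl_rel eq_sym adj_sym. Qed.
Fact compl_irr : irreflexive compl_rel.
Proof. by move=> u; rewrite /compl_rel eqxx. Qed.
Definition compl : sgraph := SGraph compl_sym compl_irr.
End Complement.

Section Products.
Variables G H : sgraph.
Implicit Types p q : G * H.

Definition cartesian_rel : rel (G * H) := fun p q =>
  ((p.1 == q.1) && (p.2 -- q.2)) || ((p.1 -- q.1) && (p.2 == q.2)).
Fact cartesian_sym : symmetric cartesian_rel.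
Proof.
by move=> p q; rewrite /cartesian_rel !(adj_sym p.1, adj_sym p.2) !(eq_sym q.1, eq_sym q.2).
Qed.
Fact cartesian_irr : irreflexive cartesian_rel.
Proof. by move=> p; rewrite /cartesian_rel !adj_irr andbF. Qed.
Definition cartesian : sgraph := SGraph cartesian_sym cartesian_irr.

Definition strong_rel : rel (G * H) := fun p q =>
  [|| (p.1 == q.1) && (p.2 -- q.2),
      (p.1 -- q.1) && (p.2 -- q.2)
    | (p.1 -- q.1) && (p.2 == q.2)].
Fact strong_sym : symmetric strong_rel.
Proof.
by move=> p q; rewrite /strong_rel !(adj_sym p.1, adj_sym p.2) !(eq_sym q.1, eq_sym q.2).
Qed.
Fact strong_irr : irreflexive strong_rel.
Proof. by move=> p; rewrite /strong_rel !adj_irr andbF. Qed.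
Definition strong : sgraph := SGraph strong_sym strong_irr.

Definition semistrong_rel : rel (G * H) := fun p q =>
  ((p.1 -- q.1) || (p.1 == q.1)) && (p.2 -- q.2).
Fact semistrong_sym : symmetric semistrong_rel.
Proof.
by move=> p q; rewrite /semistrong_rel (adj_sym p.1) (adj_sym p.2) (eq_sym q.1).
Qed.
Fact semistrong_irr : irreflexive semistrong_rel.
Proof. by move=> p; rewrite /semistrong_rel !adj_irr andbF. Qed.
Definition semistrong : sgraph := SGraph semistrong_sym semistrong_irr.

Definition lexico_rel : rel (G * H) := fun p q =>
  (p.1 -- q.1) || ((p.1 == q.1) && (p.2 -- q.2)).
Fact lexico_sym : symmetric lexico_rel.
Proof.
by move=> p q; rewrite /lexico_rel (adj_sym p.1) (adj_sym p.2) (eq_sym q.1).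
Qed.
Fact lexico_irr : irreflexive lexico_rel.
Proof. by move=> p; rewrite /lexico_rel !adj_irr andbF. Qed.
Definition lexico : sgraph := SGraph lexico_sym lexico_irr.

Definition direct_rel : rel (G * H) := fun p q =>
  (p.1 -- q.1) && (p.2 -- q.2).
Fact direct_sym : symmetric direct_rel.
Proof. by move=> p q; rewrite /direct_rel (adj_sym p.1) (adj_sym p.2). Qed.
Fact direct_irr : irreflexive direct_rel.
Proof. by move=> p; rewrite /direct_rel !adj_irr. Qed.
Definition direct : sgraph := SGraph direct_sym direct_irr.
End Products.

Section Complete.
Variable n : nat.
Definition complete_rel : rel 'I_n := fun i j => i != j.
Fact complete_sym : symmetric complete_rel.
Proof. by move=> i j; rewrite /complete_rel eq_sym. Qed.
Fact complete_irr : irreflexive complete_rel.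
Proof. by move=> i; rewrite /complete_rel eqxx. Qed.
Definition complete : sgraph := SGraph complete_sym complete_irr.
End Complete.

Notation K2 := (complete 2).

Definition autg (G : sgraph) : {set {perm G}} :=
  [set s : {perm G} | [forall u, forall v, (s u -- s v) == (u -- v)]].

Section CoordinatewisePerm.
Variables (T U : finType) (f : {perm T}) (g : {perm U}).
Definition prod_fun (p : T * U) : T * U := (f p.1, g p.2).
Fact prod_fun_inj : injective prod_fun.
Proof.
by move=> [a x] [b y] [/perm_inj -> /perm_inj ->].
Qed.
Definition prod_perm : {perm T * U} := perm prod_fun_inj.
End CoordinatewisePerm.

(* Aut(G) x Aut(K2) is identified with its image under the coordinatewise
   action, which is faithful as soon as G has a vertex. *)
Definition stable (G : sgraph) : Prop :=
  autg (direct G K2) = [set prod_perm f g | f in autg G, g in autg K2].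

Definition unstable (G : sgraph) : Prop := ~ stable G.

(* Main.v *)
(* If [f] and [g] are injective and [u ~ v] implies [f u ~ g v], then by
   finiteness the map acting as [f] on one layer of [G x K2] and as [g] on the
   other is an automorphism, and it is coordinatewise only if [f = g].  So each
   claim reduces to a pair of distinct [f], [g] on the product graph.  When only
   [Sigma] is known to be unstable, an arbitrary automorphism of [Sigma x K2] is
   lifted to the semi-strong product instead. *)

Require Import Defs.
From mathcomp Require Import all_boot all_fingroup.

Set Implicit Arguments.
Unset Strict Implicit.
Unset Printing Implicit Defensive.

(** * Edge-preserving injections of a finite graph *)

(** An injection of the finite set of points satisfying [P] into itself is onto, so no point outside
    that set can land in it. *)
Lemma inj_homo_pred_mono (T : finType) (h : T -> T) (P : pred T) :
  injective h -> (forall x, P x -> P (h x)) -> forall x, P (h x) = P x.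
Proof.
move=> h_inj hP x; set S := [set y | P y].
have eqS : h @: S = S.
  apply/eqP; rewrite eqEcard card_imset // leqnn andbT.
  by apply/subsetP=> _ /imsetP[y + ->]; rewrite !inE; apply: hP.
by have := mem_imset S x h_inj; rewrite eqS !inE.
Qed.

(** The pair [(f, g)] acts injectively on ordered pairs, and [r] is a predicate on these. *)
Lemma inj_homo_rel_mono (T : finType) (f g : T -> T) (r : rel T) :
    injective f -> injective g -> (forall x y, r x y -> r (f x) (g y)) ->
  forall x y, r (f x) (g y) = r x y.
Proof.
move=> f_inj g_inj fgr x y.
have h_inj : injective (fun p : T * T => (f p.1, g p.2)).
  by move=> [a b] [c d] [/f_inj -> /g_inj ->].
by apply: (inj_homo_pred_mono (P := fun p => r p.1 p.2) h_inj _ (x, y)) => p;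
  apply: fgr.
Qed.

Lemma autg_homo (G : sgraph) (s : {perm G}) :
  (forall u v : G, u -- v -> s u -- s v) -> s \in autg G.
Proof.
move=> sG; rewrite inE; apply/forallP=> u; apply/forallP=> v; apply/eqP.
exact: (inj_homo_rel_mono (r := @adj G) perm_inj perm_inj).
Qed.

Lemma autgP (G : sgraph) (s : {perm G}) :
  reflect (forall u v : G, (s u -- s v) = (u -- v)) (s \in autg G).
Proof.
by rewrite inE; apply: (iffP 'forall_'forall_eqP).
Qed.

Lemma prod_permE (T U : finType) (f : {perm T}) (g : {perm U}) (p : T * U) :
  prod_perm f g p = (f p.1, g p.2).
Proof. by rewrite permE. Qed.

Lemma autg_K2 (g : {perm K2}) : g \in autg K2.
Proof. by apply/autgP=> i j; rewrite /adj /= /complete_rel (inj_eq perm_inj). Qed.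

Lemma directE (G H : sgraph) (p q : direct G H) :
  (p -- q) = (p.1 -- q.1) && (p.2 -- q.2).
Proof. by []. Qed.

(** * Criteria for stability and instability *)

(** Only the coordinatewise shape matters: every permutation of [K2] is an automorphism, and the
    first factor of a coordinatewise automorphism inherits edge preservation from edges joining the
    two layers. *)
Lemma stableP (G : sgraph) :
  stable G <->
  forall s, s \in autg (direct G K2) ->
    exists (f : {perm G}) (g : {perm K2}), s = prod_perm f g.
Proof.
split=> [-> s /imset2P[f g _ _ ->]|prodG]; first by exists f, g.
apply/setP=> s; apply/idP/imset2P=> [s_aut|[f g /autgP fG /autgP gK ->]]; last first.
  by apply/autgP=> p q; rewrite !prod_permE !directE; congr andb; [apply: fG | apply: gK].
have [f [g def_s]] := prodG s s_aut; exists f g => //; last exact: autg_K2.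
apply: autg_homo => u v uv; move/autgP: s_aut => s_aut.
have := s_aut (u, ord0) (v, ord_max).
by rewrite def_s !prod_permE !directE /= uv => /andP[].
Qed.

Lemma TF_unstable (G : sgraph) (f g : G -> G) (u : G) :
    injective f -> injective g -> (forall v w : G, v -- w -> f v -- g w) ->
  f u <> g u -> unstable G.
Proof.
move=> f_inj g_inj fg neq_fg /stableP stG.
pose h (p : direct G K2) : direct G K2 :=
  (if p.2 == ord0 then f p.1 else g p.1, p.2).
have h_inj : injective h.
  by move=> [x i] [y j] [/= + eq_ij]; rewrite eq_ij; case: ifP => _ => [/f_inj|/g_inj] ->.
have h_aut : perm h_inj \in autg (direct G K2).
  apply: autg_homo => -[x i] [y j]; rewrite !permE /h !directE /=.
  case/andP=> xy ij; rewrite ij andbT; move: ij.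
  have K2E (k : K2) : k = ord0 \/ k = ord_max.
    by case: k => [[|[|//]] lt_k]; [left | right]; apply: val_inj.
  case: (K2E i) => ->; case: (K2E j) => -> //= _; first exact: fg.
  by rewrite adj_sym; apply: fg; rewrite adj_sym.
have [s [t st]] := stG _ h_aut; apply: neq_fg.
have := congr1 (fun p : {perm G * K2} => p (u, ord0)) st.
have := congr1 (fun p : {perm G * K2} => p (u, ord_max)) st.
by rewrite !prod_permE !permE /h /= => -[-> _] [-> _].
Qed.

(** Conjugating [f] and [g] by the isomorphism [h] transports the instability criterion; this serves
    to exchange the factors of a commutative product. *)
Lemma TF_unstable_iso (G H : sgraph) (h : G -> H) (k : H -> G)
    (f g : G -> G) (u : G) :
    cancel h k -> cancel k h ->
    (forall v w : G, v -- w -> h v -- h w) ->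
    (forall v w : H, v -- w -> k v -- k w) ->
    injective f -> injective g -> (forall v w : G, v -- w -> f v -- g w) ->
  f u <> g u -> unstable H.
Proof.
move=> hK kH hh hk f_inj g_inj fg neq_fg.
apply: (@TF_unstable _ (h \o f \o k) (h \o g \o k) (h u)) => [||v w vw|] /=.
- by apply: inj_comp (can_inj kH); apply: inj_comp f_inj; apply: can_inj hK.
- by apply: inj_comp (can_inj kH); apply: inj_comp g_inj; apply: can_inj hK.
- by apply/hh/fg/hk.
- by rewrite hK => /(can_inj hK).
Qed.

Lemma perm_neqP (T : finType) (s t : {perm T}) : s <> t -> exists x, s x <> t x.
Proof.
move=> neq_st; have [/forallP eq_st|] := boolP [forall x, s x == t x].
  by case: neq_st; apply/permP=> x; apply/eqP.
by rewrite negb_forall => /existsP[x /eqP]; exists x.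
Qed.

(** Transposing two vertices with equal neighbourhoods changes no adjacency to an unmoved
    endpoint. *)
Lemma R_thick_TF (G : sgraph) :
  R_thick G -> exists2 s : {perm G}, s <> 1%g & TF_morphism s 1%g.
Proof.
case=> x [y [neq_xy /setP eq_nbh]]; exists (tperm x y).
  by move/permP/(_ x); rewrite tpermL perm1 => eq_yx; apply: neq_xy.
move=> v w; have := eq_nbh w; rewrite !inE perm1 => eq_w.
by case: tpermP => [->|->|_ _]; rewrite ?eq_w.
Qed.

(** * Products with a bipartite factor *)

Definition fibrewise (T U : Type) (f : T -> U -> U) (p : T * U) : T * U :=
  (p.1, f p.1 p.2).

Lemma fibrewise_inj (T U : Type) (f : T -> U -> U) :
  (forall x, injective (f x)) -> injective (fibrewise f).
Proof. by move=> f_inj [x a] [y b] [/= <- /f_inj ->]. Qed.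

Section Bipartite.

Variables (G H : sgraph) (A : {set G}).
Hypothesis bipA : forall u v : G, u -- v -> (u \in A) != (v \in A).

(** Meant for the pair [side_map s t], [side_map t s]: the two agree at opposite ends of an edge of
    [G], while over a single vertex they form [(s, t)] or [(t, s)]. *)
Definition side_map (s t : {perm H}) (u : G) : {perm H} :=
  if u \in A then s else t.

Lemma side_map_inj (s t : {perm H}) : injective (fibrewise (side_map s t)).
Proof. by apply: fibrewise_inj => u; apply: perm_inj. Qed.

Lemma side_map_across (s t : {perm H}) (u v : G) :
  u -- v -> side_map s t u = side_map t s v.
Proof. by move/bipA; rewrite /side_map; case: (u \in A); case: (v \in A). Qed.

Lemma side_map_adj (s t : {perm H}) (u : G) (x y : H) :
  TF_morphism s t -> x -- y -> side_map s t u x -- side_map t s u y.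
Proof.
rewrite /side_map => st xy; case: ifP => _; first exact: st.
by rewrite adj_sym; apply: st; rewrite adj_sym.
Qed.

Lemma side_map_neq (s t : {perm H}) (u : G) (x : H) :
  s x <> t x -> fibrewise (side_map s t) (u, x) <> fibrewise (side_map t s) (u, x).
Proof. by move=> neq [] /=; rewrite /side_map; case: ifP => _ // /esym. Qed.

Lemma side_map_cartesian (s t : {perm H}) (p q : cartesian G H) :
    TF_morphism s t -> p -- q ->
  (fibrewise (side_map s t) p : cartesian G H) -- fibrewise (side_map t s) q.
Proof.
case: p q => [u x] [v y] st; rewrite /fibrewise /adj /= /cartesian_rel /=.
case/orP=> [/andP[/eqP <- xy]|/andP[uv /eqP <-]].
  by rewrite eqxx side_map_adj.
by rewrite uv (side_map_across _ _ uv) eqxx orbT.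
Qed.

(* Across an edge of [G] both ends move by the same permutation, so [s] itself
   has to be an automorphism. *)
Lemma side_map_strong (s : {perm H}) (p q : strong G H) :
    (forall x y : H, x -- y -> s x -- s y) -> TF_morphism s 1%g -> p -- q ->
  (fibrewise (side_map s 1%g) p : strong G H) -- fibrewise (side_map 1%g s) q.
Proof.
case: p q => [u x] [v y] ss st; rewrite /fibrewise /adj /= /strong_rel /=.
case/or3P=> [/andP[/eqP <- xy]|/andP[uv xy]|/andP[uv /eqP <-]].
- by rewrite eqxx side_map_adj.
- rewrite uv (side_map_across _ _ uv) /side_map.
  by case: ifP => _; rewrite ?perm1 ?xy ?ss ?orbT.
- by rewrite uv (side_map_across _ _ uv) eqxx !orbT.
Qed.

End Bipartite.

(** Moving one endpoint of an edge, then the other after reversing it, moves both by [s]. *)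
Lemma TF_id_homo (G : sgraph) (s : {perm G}) :
  TF_morphism s 1%g -> forall x y : G, x -- y -> s x -- s y.
Proof.
move=> st x y /st; rewrite perm1 adj_sym => /st.
by rewrite perm1 adj_sym.
Qed.

Definition swap (T U : Type) (p : T * U) : U * T := (p.2, p.1).

Lemma swapK (T U : Type) : cancel (@swap T U) (@swap U T).
Proof. by case. Qed.

Lemma swap_cartesian (G H : sgraph) (p q : cartesian G H) :
  p -- q -> (swap p : cartesian H G) -- swap q.
Proof.
by rewrite /adj /= /cartesian_rel /= orbC andbC [X in _ || X]andbC.
Qed.

Lemma swap_strong (G H : sgraph) (p q : strong G H) :
  p -- q -> (swap p : strong H G) -- swap q.
Proof.
rewrite /adj /= /strong_rel /=.
by case/or3P=> /andP[-> ->]; rewrite ?orbT.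
Qed.

(** * TFS-morphisms and closed adjacency *)

Definition closed_adj (G : sgraph) : rel G := fun u v => (u == v) || (u -- v).

(** With a loop added at every vertex, the strong product becomes the direct product of the looped
    factors; the loops absorb the case [p = q]. *)
Lemma compl_strongE (G H : sgraph) (p q : compl (strong G H)) :
  (p -- q) = ~~ (closed_adj p.1 q.1 && closed_adj p.2 q.2).
Proof.
case: p q => [u x] [v y]; rewrite /adj /= /compl_rel /adj /= /strong_rel /=.
rewrite /closed_adj xpair_eqE.
by case: (u == v); case: (x == y); case: (u -- v); case: (x -- y).
Qed.

(** The two TFS conditions together say that closed adjacency is preserved. Finiteness makes this an
    equivalence, which is what passing to a complement requires. *)
Lemma TFS_closed_adj (G : sgraph) (s t : {perm G}) (u v : G) :
  TFS_morphism s t -> closed_adj (s u) (t v) = closed_adj u v.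
Proof.
case=> st_pt st_adj; apply: (inj_homo_rel_mono perm_inj perm_inj) => {}u {}v.
rewrite /closed_adj => /predU1P[->|/st_adj[->|->]]; rewrite ?st_pt ?eqxx ?orbT //.
Qed.

Lemma TFS_neq (G : sgraph) (s t : {perm G}) (u : G) :
  TFS_morphism s t -> s u <> t u.
Proof. by case=> /(_ u) + _ eq_st; rewrite eq_st adj_irr. Qed.

Lemma prod_fun_neql (T U : finType) (s t : {perm T}) (r : {perm U}) x y :
  s x <> t x -> prod_fun s r (x, y) <> prod_fun t r (x, y).
Proof. by move=> neq []. Qed.

Lemma prod_fun_neqr (T U : finType) (r : {perm T}) (s t : {perm U}) x y :
  s y <> t y -> prod_fun r s (x, y) <> prod_fun r t (x, y).
Proof. by move=> neq []. Qed.

(** * Lifting automorphisms to the semi-strong product *)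

Lemma semistrongE (G H : sgraph) (p q : semistrong G H) :
  (p -- q) = closed_adj p.1 q.1 && (p.2 -- q.2).
Proof. by rewrite /closed_adj orbC. Qed.

Lemma stable_semistrong_snd (G H : sgraph) (u0 : G) :
  stable (semistrong G H) -> stable H.
Proof.
move/stableP=> st; apply/stableP=> s /autgP s_aut.
pose h (p : direct (semistrong G H) K2) : direct (semistrong G H) K2 :=
  let q := s (p.1.2, p.2) in ((p.1.1, q.1), q.2).
have h_inj : injective h.
  move=> [[u x] i] [[v y] j] [/= <- eq1 eq2].
  have /perm_inj[-> ->] // : s (x, i) = s (y, j).
  by rewrite [LHS]surjective_pairing eq1 eq2 -surjective_pairing.
have h_aut : perm h_inj \in autg (direct (semistrong G H) K2).
  apply/autgP=> -[[u x] i] [[v y] j]; rewrite !permE /h.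
  (* Adjacency splits into closed adjacency in [G], whose coordinate [h] fixes, and adjacency in
     [direct H K2], which [s] preserves. *)
  rewrite !directE !semistrongE -!andbA; congr andb.
  exact: s_aut (x, i) (y, j).
have [f [g fg]] := st _ h_aut.
have fgE u x i : ((u, (s (x, i)).1), (s (x, i)).2) = (f (u, x), g i).
  have := congr1 (fun p : {perm _} => p ((u, x), i)) fg.
  by rewrite prod_permE !permE.
(* The decomposition of the lift is read off on the single fibre over [u0]. *)
pose f0 (x : H) : H := (f (u0, x)).2.
have sE x i : s (x, i) = (f0 x, g i).
  have [eq1 eq2] := fgE u0 x i.
  by rewrite [s _]surjective_pairing /f0 -eq1 -eq2.
have f0_inj : injective f0.
  move=> x y eq_f; have := @perm_inj _ s (x, ord0) (y, ord0).
  by rewrite !sE eq_f => /(_ erefl)[].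
exists (perm f0_inj), g; apply/permP=> -[x i].
by rewrite prod_permE sE !permE.
Qed.

Theorem theorem1p3 (Gamma Sigma : sgraph)
    (hGamma : connected Gamma) (hSigma : connected Sigma)
    (cGamma : 2 <= #|Gamma|) (cSigma : 2 <= #|Sigma|) :
  [/\ (bipartite Gamma /\
         (exists alpha beta : {perm Sigma},
             TF_morphism alpha beta /\ alpha <> beta)) \/
      (bipartite Sigma /\
         (exists alpha beta : {perm Gamma},
             TF_morphism alpha beta /\ alpha <> beta)) ->
      unstable (cartesian Gamma Sigma),
      (bipartite Gamma /\ R_thick Sigma) \/
      (bipartite Sigma /\ R_thick Gamma) ->
      unstable (strong Gamma Sigma),
      (exists alpha beta : {perm Gamma}, TFS_morphism alpha beta) \/
      (exists alpha beta : {perm Sigma}, TFS_morphism alpha beta) ->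
      unstable (compl (strong Gamma Sigma)),
      unstable Sigma \/
      (exists alpha beta : {perm Gamma}, TFS_morphism alpha beta) ->
      unstable (semistrong Gamma Sigma)
    & (exists alpha beta : {perm Sigma},
          TF_morphism alpha beta /\ alpha <> beta) ->
      unstable (lexico Gamma Sigma)].
Proof.
have [u0 _] : exists u : Gamma, u \in Gamma by apply/card_gt0P; apply: ltnW.
have [x0 _] : exists x : Sigma, x \in Sigma by apply/card_gt0P; apply: ltnW.
split.
- case=> -[[A bipA] [s [t [st /perm_neqP[x neq]]]]].
    apply: (TF_unstable (G := cartesian Gamma Sigma)
      (@side_map_inj _ _ A s t) (@side_map_inj _ _ A t s)).
      by move=> v w; apply: side_map_cartesian.
    exact: (@side_map_neq _ _ A s t u0 x neq).
  (* The colouring must live on the first factor, so the factors are exchanged. *)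
  apply: (TF_unstable_iso (G := cartesian Sigma Gamma) (H := cartesian Gamma Sigma)
    (@swapK _ _) (@swapK _ _)
    (@swap_cartesian _ _) (@swap_cartesian _ _)
    (@side_map_inj _ _ A s t) (@side_map_inj _ _ A t s)).
    by move=> v w; apply: side_map_cartesian.
  exact: (@side_map_neq _ _ A s t x0 x neq).
- case=> -[[A bipA] /R_thick_TF[s /perm_neqP[x neq] st]].
    apply: (TF_unstable (G := strong Gamma Sigma)
      (@side_map_inj _ _ A s 1%g) (@side_map_inj _ _ A 1%g s)).
      by move=> v w; apply: side_map_strong => //; apply: TF_id_homo.
    exact: (@side_map_neq _ _ A s 1%g u0 x neq).
  apply: (TF_unstable_iso (G := strong Sigma Gamma) (H := strong Gamma Sigma)
    (@swapK _ _) (@swapK _ _)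
    (@swap_strong _ _) (@swap_strong _ _)
    (@side_map_inj _ _ A s 1%g) (@side_map_inj _ _ A 1%g s)).
    by move=> v w; apply: side_map_strong => //; apply: TF_id_homo.
  exact: (@side_map_neq _ _ A s 1%g x0 x neq).
(* Any base point witnesses that the two maps differ, since [s u] and [t u] are adjacent for every
   [u]. *)
- case=> -[s [t st]].
    apply: (TF_unstable (G := compl (strong Gamma Sigma))
      (@prod_fun_inj _ _ s 1%g) (@prod_fun_inj _ _ t 1%g)).
      by move=> v w; rewrite !compl_strongE /= (TFS_closed_adj _ _ st) !perm1.
    exact: (@prod_fun_neql _ _ s t 1%g u0 x0 (TFS_neq st)).
  apply: (TF_unstable (G := compl (strong Gamma Sigma))
    (@prod_fun_inj _ _ 1%g s) (@prod_fun_inj _ _ 1%g t)).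
    by move=> v w; rewrite !compl_strongE /= (TFS_closed_adj _ _ st) !perm1.
  exact: (@prod_fun_neqr _ _ 1%g s t u0 x0 (TFS_neq st)).
- case=> [unst /(stable_semistrong_snd u0) //|[s [t st]]].
  apply: (TF_unstable (G := semistrong Gamma Sigma)
    (@prod_fun_inj _ _ s 1%g) (@prod_fun_inj _ _ t 1%g)).
    by move=> v w; rewrite !semistrongE /= (TFS_closed_adj _ _ st) !perm1.
  exact: (@prod_fun_neql _ _ s t 1%g u0 x0 (TFS_neq st)).
- case=> s [t [st /perm_neqP[x neq]]].
  apply: (TF_unstable (G := lexico Gamma Sigma)
    (@prod_fun_inj _ _ 1%g s) (@prod_fun_inj _ _ 1%g t)).
    (* Edges between different fibres ignore the second coordinate, so only edges inside a fibre use
       the TF condition. *)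
    move=> v w; rewrite /adj /= /lexico_rel /= !perm1.
    by case/orP=> [->//|/andP[-> /st ->]]; rewrite orbT.
  exact: (@prod_fun_neqr _ _ 1%g s t u0 x neq).
Qed.
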